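(* Let $r,k,\delta$ be integers with $r\geq 2$ and $k\geq 1$. Let $G$ be a graph of order $n\geq 2\delta+k+1$ with $nk$ even and minimum degree at least $\delta$. For integers $n,r,q,k$ put $$\varphi(n,r,q)=\binom{n-q-1}{r}+(q+1)\binom{q}{r-1},\qquad \phi(n,r,k,q)=\binom{n-q+2k-4}{r}+(q-2k+4)\binom{q}{r-1}.$$ (i) Suppose in addition that $n$ is even. If $1\leq\delta\leq \frac{n}{2}-1$ and $N_r(G)>\max\{\varphi(n,r,\delta+1),\varphi(n,r,\frac n2-1)\}$, then $G$ has a $1$-factor, or $\delta$ is even and $C_{n-1}(G)\cong K_{n-\delta-1}+K_{\delta+1}$, or $C_{n-1}(G)\cong K_{\delta}\vee(K_{n-2\delta-1}+I_{\delta+1})$. (ii) If $k\geq 2$, $2k-2\leq \delta\leq \lfloor\frac{n+2k-5}{2}\rfloor$ and $N_r(G)>\max\{\phi(n,r,k,\delta+1),\phi(n,r,k,\lfloor\frac{n+2k-5}{2}\rfloor)\}$, then $G$ has a $k$-factor.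
   Context: All graphs are finite and simple. $N_r(G)$ denotes the number of cliques of size $r$ in $G$. A $k$-factor of $G$ is a $k$-regular spanning subgraph. $K_n$ is the complete graph and $I_n$ the edgeless graph on $n$ vertices. $G_1+G_2$ denotes the disjoint union and $G_1\vee G_2$ the join (disjoint union plus all edges between $V(G_1)$ and $V(G_2)$). For a positive integer $l$, the $l$-closure $C_l(G)$ of a graph $G$ is the graph obtained from $G$ by repeatedly joining pairs of nonadjacent vertices whose degree sum (in the current graph) is at least $l$, until no such pair remains. *)

(* Defs.v *)
From mathcomp Require Import all_boot.
Set Implicit Arguments. Unset Strict Implicit. Unset Printing Implicit Defensive.

Section Graphs.
Variable T : finType.

Definition simple_graph (g : rel T) : Prop :=
  irreflexive g /\ symmetric g.

Definition deg (g : rel T) (x : T) : nat := #|[set y | g x y]|.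

Definition is_clique (g : rel T) (S : {set T}) : bool :=
  [forall x in S, forall y in S, (x != y) ==> g x y].

Definition Nr (g : rel T) (r : nat) : nat :=
  #|[set S : {set T} | is_clique g S & #|S| == r]|.

Definition has_kfactor (g : rel T) (k : nat) : Prop :=
  exists f : rel T, symmetric f /\ (forall x y, f x y -> g x y) /\
    (forall x, deg f x = k).

Definition add_edge (g : rel T) (u v : T) : rel T :=
  fun x y => g x y || ((x == u) && (y == v)) || ((x == v) && (y == u)).

Inductive closure_reach (l : nat) (g : rel T) : rel T -> Prop :=
| CR0 : closure_reach l g g
| CRS (h : rel T) (u v : T) : closure_reach l g h -> u != v -> ~~ h u v ->
    l <= deg h u + deg h v -> closure_reach l g (add_edge h u v).

Definition is_closure (l : nat) (g h : rel T) : Prop :=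
  closure_reach l g h /\
  (forall u v, u != v -> ~~ h u v -> deg h u + deg h v < l).

Definition iso_to (n : nat) (g : rel T) (K : rel 'I_n) : Prop :=
  exists f : T -> 'I_n, bijective f /\ forall x y, g x y = K (f x) (f y).
End Graphs.
Arguments iso_to {T} n g K.

Definition two_cliques (n a : nat) : rel 'I_n :=
  fun i j => (i != j) && ((i < a) == (j < a)).

(* K_d \/ (K_(n-2d-1) + I_(d+1)) on 'I_n : A = {i < d},
   B = {d <= i < n-d-1}, C = {n-d-1 <= i} *)
Definition join_graph (n d : nat) : rel 'I_n :=
  fun i j => (i != j) &&
    [|| i < d, j < d | ((i < n - d - 1) && (j < n - d - 1))].

Definition varphi (n r q : nat) : nat :=
  'C(n - q - 1, r) + (q + 1) * 'C(q, r.-1).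

Definition phi (n r k q : nat) : nat :=
  'C(n + 2 * k - 4 - q, r) + (q + 4 - 2 * k) * 'C(q, r.-1).
Arguments two_cliques n a i j : clear implicits.
Arguments join_graph n d i j : clear implicits.

(* Main.v *)
Require Import Defs.
From mathcomp Require Import all_boot zify.
Set Implicit Arguments. Unset Strict Implicit. Unset Printing Implicit Defensive.

(** Put l = n - 1 if k = 1 and l = n + 2k - 4 if k >= 2.  Having a k-factor is
    stable under adding an edge between nonadjacent vertices of degree sum at
    least l, so G may be replaced by its l-closure H, which has at least as many
    r-cliques.  In H take nonadjacent u, v with deg u <= deg v and maximal degree
    sum among the pairs of degree > delta: the non-neighbours of v are n + q - l
    vertices of degree at most q = deg u, which bounds N_r(H) by
    C(l - q, r) + (n + q - l) C(q, r - 1).  This is convex in q, contradicting the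
    hypothesis.  So the vertices of degree > delta form a clique and the set D of
    vertices of degree delta is small; then D has exactly n + delta - l vertices
    and every other vertex is joined to all of D or to none of it.  In such a
    graph a k-factor is built from inside out: a subgraph of H[D] of maximum
    degree k with enough edges, then edges from D to its common neighbours, then
    a graph with the remaining degrees on the clique.  This fails only for the
    two exceptional graphs with k = 1. *)

(** * Edges, switches and degree counting *)

Section Edges.
Variable T : finType.
Implicit Types (g h F : rel T) (u v x y : T) (A B D Z : {set T}).

Definition del_edge g u v : rel T :=
  fun x y => g x y && ~~ (((x == u) && (y == v)) || ((x == v) && (y == u))).

Lemma deg_sum g x : deg g x = \sum_y g x y.
Proof. by rewrite /deg cardsE -sum1_card big_mkcond; apply: eq_bigr => y _; rewrite unfold_in; case: (g x y). Qed.

Lemma add_edge_sym g u v : symmetric g -> symmetric (add_edge g u v).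
Proof. by move=> gs x y; rewrite /add_edge gs -!orbA; congr orb; rewrite orbC ![(y == _) && _]andbC. Qed.

Lemma del_edge_sym g u v : symmetric g -> symmetric (del_edge g u v).
Proof. by move=> gs x y; rewrite /del_edge gs; congr (_ && ~~ _); rewrite orbC ![(y == _) && _]andbC. Qed.

Lemma add_edge_irr g u v : u != v -> irreflexive g -> irreflexive (add_edge g u v).
Proof.
move=> uv gi x; rewrite /add_edge gi /=.
by case: (eqVneq x u) => [->|_] /=; rewrite ?(negPf uv) ?andbF.
Qed.

Lemma sum_pick (b : bool) v : \sum_(y : T) (b && (y == v) : nat) = b.
Proof.
rewrite (bigD1 v) //= eqxx andbT big1 ?addn0 // => y /negPf ->.
by rewrite andbF.
Qed.

Lemma deg_add g u v x : symmetric g -> u != v -> ~~ g u v ->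
  deg (add_edge g u v) x = deg g x + (x == u) + (x == v).
Proof.
move=> gs uv nuv; rewrite !deg_sum -(sum_pick (x == u) v) -(sum_pick (x == v) u).
rewrite -!big_split /=; apply: eq_bigr => y _; rewrite /add_edge.
case: (eqVneq x u) => [->|xu] /=; case: (eqVneq y v) => [->|yv] /=.
- by rewrite (negPf nuv) (negPf uv).
- by rewrite (negPf uv) /= !orbF !addn0.
- case: (eqVneq x v) => [->|xv] /=; last by rewrite !orbF !addn0.
  by rewrite (eq_sym v u) (negPf uv) !orbF !addn0.
- case: (eqVneq x v) => [->|xv] /=; last by rewrite !orbF !addn0.
  by case: (eqVneq y u) => [->|yu] /=; rewrite ?orbF ?addn0 // gs (negPf nuv).
Qed.

Lemma deg_del g u v x : symmetric g -> u != v -> g u v ->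
  deg g x = deg (del_edge g u v) x + (x == u) + (x == v).
Proof.
move=> gs uv guv; rewrite !deg_sum -(sum_pick (x == u) v) -(sum_pick (x == v) u).
rewrite -!big_split /=; apply: eq_bigr => y _; rewrite /del_edge.
case: (eqVneq x u) => [->|xu] /=; case: (eqVneq y v) => [->|yv] /=.
- by rewrite guv (negPf uv).
- by rewrite (negPf uv) /= andbT !addn0.
- case: (eqVneq x v) => [->|xv] /=; last by rewrite andbT !addn0.
  by rewrite (eq_sym v u) (negPf uv) andbT !addn0.
- case: (eqVneq x v) => [->|xv] /=; last by rewrite andbT !addn0.
  by case: (eqVneq y u) => [->|yu] /=; rewrite ?andbT ?andbF ?addn0 // gs guv.
Qed.

Lemma add_edgeE g u v x y : add_edge g u v x y ->
  g x y \/ (x = u /\ y = v) \/ (x = v /\ y = u).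
Proof.
by case/orP => [/orP[|/andP[/eqP-> /eqP->]]|/andP[/eqP-> /eqP->]]; auto.
Qed.

Lemma del_edgeE g u v x y : del_edge g u v x y -> g x y.
Proof. by case/andP. Qed.

Lemma add_edgeF g u v x y : ~~ g x y -> x != u \/ y != v -> x != v \/ y != u ->
  ~~ add_edge g u v x y.
Proof.
move=> ng d1 d2; rewrite /add_edge (negPf ng) /= negb_or !negb_and.
by apply/andP; split; apply/orP.
Qed.

(* Opens the walk u-x-y-v: the non-edges ux and vy replace the edge xy. *)
Definition switch F u x y v := del_edge (add_edge (add_edge F u x) v y) x y.

Lemma switch_sym F u x y v : symmetric F -> symmetric (switch F u x y v).
Proof. by move=> Fs; apply: del_edge_sym; do 2!apply: add_edge_sym. Qed.

Lemma switchE F u x y v a b : switch F u x y v a b ->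
  [\/ F a b, (a = u /\ b = x) \/ (a = x /\ b = u) | (a = v /\ b = y) \/ (a = y /\ b = v)].
Proof.
move/del_edgeE => /add_edgeE[/add_edgeE[|]|] H;
  by [apply: Or31 | apply: Or32 | apply: Or33].
Qed.

Lemma switch_irr F u x y v : u != x -> v != y -> irreflexive F ->
  irreflexive (switch F u x y v).
Proof.
move=> ux vy Fi z; apply/negP => /switchE[|[] [zu zx]|[] [zu zx]].
- by rewrite Fi.
- by rewrite -zu -zx eqxx in ux.
- by rewrite -zu -zx eqxx in ux.
- by rewrite -zu -zx eqxx in vy.
- by rewrite -zu -zx eqxx in vy.
Qed.

(** Together with [x != y], the disjunction says that the two added edges are distinct. The case
    [u = v] is allowed: that vertex then gains two. *)
Lemma switch_deg F u x y v z : symmetric F -> u != x -> v != y -> x != y ->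
  u != y \/ x != v -> ~~ F u x -> ~~ F v y -> F x y ->
  deg (switch F u x y v) z = deg F z + (z == u) + (z == v).
Proof.
move=> Fs ux vy xy d nux nvy Fxy.
pose F1 := add_edge F u x; pose F2 := add_edge F1 v y.
have F1s : symmetric F1 by exact: add_edge_sym.
have F2s : symmetric F2 by exact: add_edge_sym.
have nF1 : ~~ F1 v y.
  apply: add_edgeF => //; first by right; rewrite eq_sym.
  by case: d => d; [right | left]; rewrite eq_sym.
have F2xy : F2 x y by rewrite /F2 /F1 /add_edge Fxy.
have := deg_del z F2s xy F2xy.
rewrite (deg_add z F1s vy nF1) (deg_add z Fs ux nux) -/(switch F u x y v).
by clear; lia.
Qed.

Lemma deg_gt0P g x : reflect (exists y, g x y) (0 < deg g x).
Proof.
rewrite /deg; apply: (iffP (@card_gt0P _ _)) => [[y]|[y gxy]]; last by exists y; rewrite inE.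
by rewrite inE; exists y.
Qed.

(** Handshake: ordered adjacent pairs are split by the order of [enum_rank], and swapping the
    coordinates exchanges the two halves. *)
Lemma sum_deg_even g : symmetric g -> irreflexive g -> ~~ odd (\sum_x deg g x).
Proof.
move=> gs gi.
under eq_bigr => x _ do rewrite deg_sum.
pose lt (p : T * T) := enum_rank p.1 < enum_rank p.2.
rewrite pair_big /= (bigID lt) /=.
suff -> : \sum_(p | ~~ lt p) (g p.1 p.2 : nat) = \sum_(p | lt p) (g p.1 p.2 : nat).
  by rewrite addnn odd_double.
have swapK : involutive (fun p : T * T => (p.2, p.1)) by case.
rewrite (reindex_inj (inv_inj swapK)) /= [RHS]big_mkcond [LHS]big_mkcond /=.
apply: eq_bigr => -[x y] _ /=; rewrite /lt /= gs.
case: (ltngtP (enum_rank x) (enum_rank y)) => // /val_inj/enum_rank_inj->.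
by rewrite gi.
Qed.

(* The total degree is bounded, so a process that keeps increasing it stops. *)
Lemma augment (P Q : rel T -> Prop) :
  (forall F, P F -> Q F \/
     exists F', P F' /\ \sum_x deg F x < \sum_x deg F' x) ->
  forall F, P F -> exists F', P F' /\ Q F'.
Proof.
move=> step F PF.
have bound F' : \sum_x deg F' x <= #|T| * #|T|.
  rewrite -sum_nat_const; apply: leq_sum => x _; exact: max_card.
move: {2}(#|T| * #|T| - _) (leqnn (#|T| * #|T| - \sum_x deg F x)) => m.
elim: m F PF => [|m IH] F PF le_m.
  case: (step F PF) => [|[F' [_ lt]]]; first by exists F.
  by have := bound F'; lia.
case: (step F PF) => [|[F' [PF' lt]]]; first by exists F.
by apply: (IH F' PF'); have := bound F'; lia.
Qed.

Lemma sum_deg_lt g h u : (forall x, deg g x <= deg h x) -> deg g u < deg h u ->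
  \sum_x deg g x < \sum_x deg h x.
Proof.
move=> le lt; rewrite (bigD1 u) //= [X in _ < X](bigD1 u) //= -addSn.
by apply: leq_add => //; apply: leq_sum.
Qed.

Lemma card_in_sum g A x : #|[set y in A | g x y]| = \sum_(y in A) (g x y : nat).
Proof.
rewrite -sum1_card [RHS]big_mkcond [LHS]big_mkcond.
by apply: eq_bigr => y _; rewrite inE; case: (y \in A); case: (g x y).
Qed.

Lemma double_count g A B : symmetric g ->
  \sum_(x in A) #|[set y in B | g x y]| = \sum_(y in B) #|[set x in A | g y x]|.
Proof.
move=> gs.
under eq_bigr => x _ do rewrite card_in_sum.
under [RHS]eq_bigr => x _ do rewrite card_in_sum.
by rewrite exchange_big; apply: eq_bigr => y _; apply: eq_bigr => x _; rewrite gs.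
Qed.

Lemma ex_nbr_out g A x : #|A| < deg g x -> exists2 y, g x y & y \notin A.
Proof.
move=> lt; case: (pickP [pred y | g x y & y \notin A]) => [y /andP[]|no]; first by exists y.
have : [set y | g x y] \subset A.
  by apply/subsetP => y; rewrite inE => gxy; have := no y; rewrite /= gxy => /negbFE.
by move/subset_leq_card; rewrite -/(deg g x); lia.
Qed.

Lemma ex_subset_card A s : s <= #|A| -> exists2 B : {set T}, B \subset A & #|B| = s.
Proof.
move=> les; have : 0 < #|[set B : {set T} | B \subset A & #|B| == s]|.
  by rewrite cards_draws bin_gt0.
by case/card_gt0P => B; rewrite inE => /andP[sBA /eqP]; exists B.
Qed.

End Edges.

(** * Bondy-Chvatal stability *)

Section Stab.
Variable T : finType.
Implicit Types (g h F : rel T) (u v x y : T) (A B D Z : {set T}).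

(** Count the [F]-edges between [A] and [Z] from both sides. A vertex of [A] sends its [k] edges
    into [Z], except possibly one to [v]; of the [k] edges at a vertex of [Z], those to [u] and [v]
    do not end in [A]. *)
Lemma count_nbrs F A Z u v k : symmetric F -> u != v ->
  (forall x, x \in A -> deg F x = k) -> (forall z, z \in Z -> deg F z = k) ->
  u \notin A -> v \notin A ->
  (forall x y, x \in A -> F x y -> y \in Z \/ y = v) ->
  k * #|A| + #|[set z in Z | F u z]| + #|[set z in Z | F v z]|
    <= k * #|Z| + #|[set x in A | F v x]|.
Proof.
move=> Fs uv degA degZ uA vA nbrA.
have le1 : k * #|A| <= \sum_(x in A) (#|[set z in Z | F x z]| + F v x).
  rewrite mulnC -sum_nat_const; apply: leq_sum => x xA; rewrite -(degA x xA).
  have sub : [set y | F x y] \subset [set z in Z | F x z] :|: (if F v x then [set v] else set0).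
    apply/subsetP => y; rewrite !inE => Fxy.
    case: (nbrA _ _ xA Fxy) => [->|yv]; first by rewrite Fxy.
    by rewrite -yv (Fs y) Fxy inE eqxx orbT.
  apply: leq_trans (subset_leq_card sub) _; apply: leq_trans (leq_card_setU _ _) _.
  by rewrite leq_add2l; case: (F v x); rewrite ?cards1 ?cards0.
have le2 : \sum_(z in Z) (#|[set x in A | F z x]| + F u z + F v z) <= k * #|Z|.
  rewrite mulnC -sum_nat_const; apply: leq_sum => z zZ; rewrite -(degZ z zZ).
  rewrite deg_sum (bigD1 u) //= (bigD1 v) 1?eq_sym //= card_in_sum (Fs u) (Fs v).
  suff : \sum_(y in A) (F z y : nat) <= \sum_(i | (i != u) && (i != v)) F z i by lia.
  rewrite big_mkcond [X in _ <= X]big_mkcond; apply: leq_sum => y _.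
  case: (boolP (y \in A)) => // yA.
  by rewrite (memPn uA _ yA) (memPn vA _ yA).
move: le1 le2; rewrite !big_split /= (double_count _ _ Fs) -!card_in_sum; lia.
Qed.

(* From a k-factor through [uv], delete [uv]; either a
   path u-x-y-v with xy the only factor edge, or (for k >= 2) a pair of switches
   meeting at v, restores the two degrees without using [uv]. *)
Lemma kfactor_add_edge g u v k : simple_graph g -> 0 < k -> u != v -> ~~ g u v ->
  #|T| + (if k == 1 then 0 else 2 * k - 3) - 1 <= deg g u + deg g v ->
  has_kfactor (add_edge g u v) k -> has_kfactor g k.
Proof.
move=> [gi gs] k0 uv nguv dsum [F [Fs [Fsub Fdeg]]].
case: (boolP (F u v)) => Fuv; last first.
  exists F; split=> //; split=> // x y Fxy.
  case: (add_edgeE (Fsub _ _ Fxy)) => [//|[[xu yv]|[xv yu]]].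
    by rewrite -xu -yv Fxy in Fuv.
  by rewrite -xv -yu Fs Fxy in Fuv.
pose H := del_edge F u v.
have Hs : symmetric H := del_edge_sym u v Fs.
have Hg x y : H x y -> g x y.
  move=> /[dup] /del_edgeE Fxy; case: (add_edgeE (Fsub _ _ Fxy)) => [//|].
  by rewrite /H /del_edge => -[[-> ->]|[-> ->]]; rewrite !eqxx /= ?orbT andbF.
have Hdeg x : k = deg H x + (x == u) + (x == v).
  by rewrite -(deg_del x Fs uv Fuv) Fdeg.
have vu : v != u by rewrite eq_sym.
have degu : deg H u = k.-1 by have := Hdeg u; rewrite eqxx (negPf uv); lia.
have degv : deg H v = k.-1 by have := Hdeg v; rewrite eqxx (negPf vu); lia.
have gu x : g u x -> x != u /\ x != v.
  by move=> gux; split; apply/eqP => E; move: gux; rewrite E ?gi ?(negPf nguv).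
have gv x : g v x -> x != u /\ x != v.
  by move=> gvx; split; apply/eqP => E; move: gvx; rewrite E ?gi // gs (negPf nguv).
have Hk x : x != u -> x != v -> deg H x = k.
  by move=> xu xv; have := Hdeg x; rewrite (negPf xu) (negPf xv); lia.
have Hi x : H x x = false by apply/negP => /Hg; rewrite gi.
(* [A] and [B] collect the edges of [g] at [u] and at [v] that are still free to be added to [H]. *)
pose A := [set x | g u x & ~~ H u x]; pose B := [set x | g v x & ~~ H v x].
have cardN (w : T) : deg g w = #|[set x | g w x & ~~ H w x]| + deg H w.
  rewrite /deg -(cardsID [set x | H w x] [set x | g w x]) addnC; congr addn.
    by apply: eq_card => x; rewrite !inE andbC.
  by apply: eq_card => x; rewrite !inE; case: (boolP (H w x)) => [/Hg->|]; rewrite ?andbF.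
have cA := cardN u; have cB := cardN v; rewrite degu -/A in cA; rewrite degv -/B in cB.
case: (boolP [exists x in A, exists y in B, H x y]) => [|noE1].
  case/exists_inP => x; rewrite inE => /andP[gux nHux] /exists_inP[y].
  rewrite inE => /andP[gvy nHvy] Hxy.
  have [xu xv] := gu x gux; have [yu yv] := gv y gvy.
  have xy : x != y by apply/eqP => E; rewrite E Hi in Hxy.
  have ux : u != x by rewrite eq_sym.
  have vy : v != y by rewrite eq_sym.
  exists (switch H u x y v); split; first exact: switch_sym.
  split=> [a b /switchE|z].
    by case=> [/Hg//|[] [-> ->]|[] [-> ->]] //; rewrite gs.
  by rewrite switch_deg //; right.
have noAB x y : x \in A -> y \in B -> H x y = false.
  move=> xA yB; apply: contraNF noE1 => Hxy.
  by apply/exists_inP; exists x => //; apply/exists_inP; exists y.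
have uA : u \notin A by rewrite inE gi.
have vA : v \notin A by rewrite inE (negPf nguv).
have vB : v \notin B by rewrite inE gi.
have uB : u \notin B by rewrite inE gs (negPf nguv).
have nHuv : ~~ H u v by apply: contra nguv; exact: Hg.
(* With no [H]-edge between [A] and [B], the [H]-neighbours of [A] lie in [Z] or equal [v]. For
   [k = 1] this count gives [#|A| + #|B| <= #|T| - 2], against the degree sum. *)
pose Z := ~: (u |: (v |: B)).
have cardZ : #|Z| + 2 + #|B| = #|T|.
  by rewrite -(cardsC Z) /Z setCK !cardsU1 !inE (negPf uv) gi gs (negPf nguv) /=; clear; lia.
have count1 : k * #|A| + #|[set z in Z | H u z]| + #|[set z in Z | H v z]|
    <= k * #|Z| + #|[set x in A | H v x]|.
  apply: count_nbrs => //.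
  - by move=> x; rewrite inE => /andP[/gu[xu xv] _]; apply: Hk.
  - by move=> z; rewrite !inE !negb_or => /andP[zu /andP[zv _]]; apply: Hk.
  - move=> x y xA Hxy; case: (eqVneq y v) => [|yv]; [by right|left].
    rewrite !inE (negPf yv) /=; apply/norP; split.
      by apply/eqP => E; move: xA; rewrite inE -E Hs Hxy andbF.
    by apply/negP => yB; rewrite (noAB x y) // inE in Hxy.
have ZNv : #|[set z in Z | H v z]| = k.-1.
  rewrite -degv /deg; apply: eq_card => z; rewrite !inE.
  case: (boolP (H v z)) => [Hvz|]; rewrite ?andbF //= andbT.
  by have [/negPf-> /negPf->] := gv z (Hg _ _ Hvz).
have leAv : #|[set x in A | H v x]| <= k.-1.
  by rewrite -degv; apply: subset_leq_card; apply/subsetP => x; rewrite !inE => /andP[].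
case: (eqVneq k 1) => k1.
  by move: dsum count1 leAv cA cB cardZ; rewrite k1; clear; lia.
rewrite (negPf k1) in dsum.
have k2 : 1 < k by clear -k0 k1; lia.
(* The degree sum now gives [#|A| + #|B| >= #|T| - 2]. Feeding this into [count1] leaves at least
   [k - 1 > 0] edges of [H] from [v] to [A]; one of them is [vx]. *)
have leZA : #|Z| <= #|A| by clear -k2 cA cB cardZ dsum; lia.
have /card_gt0P[x] : 0 < #|[set x in A | H v x]|.
  have : k * #|Z| <= k * #|A| by rewrite leq_mul2l leZA orbT.
  by clear -count1 ZNv k2; lia.
rewrite inE => /andP[xA Hvx].
have [gux nHux] : g u x /\ ~~ H u x by move: xA; rewrite inE => /andP.
have [xu xv] := gu x gux.
case: (boolP [exists a in B, exists b in B, H a b]) => [|noE2].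
  case/exists_inP => a; rewrite inE => /andP[gva nHva] /exists_inP[b].
  rewrite inE => /andP[gvb nHvb] Hab.
  have [au av] := gv a gva; have [bu bv] := gv b gvb.
  have ab : a != b by apply/eqP => E; rewrite E Hi in Hab.
  have xa : x != a by apply/eqP => E; rewrite -E Hvx in nHva.
  have xb : x != b by apply/eqP => E; rewrite -E Hvx in nHvb.
  (* The edges [ux], [va], [vb] replace [ab] and [vx]: the degrees of [x], [a], [b] are kept, and
     [u] and [v] gain one each. *)
  pose H1 := add_edge H u x; pose H2 := add_edge H1 v a; pose H3 := add_edge H2 v b.
  have H1s : symmetric H1 by exact: add_edge_sym.
  have H2s : symmetric H2 by exact: add_edge_sym.
  have H3s : symmetric H3 by exact: add_edge_sym.
  have nH1 : ~~ H1 v a by apply: add_edgeF => //; left; rewrite // eq_sym.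
  have nH2 : ~~ H2 v b.
    apply: add_edgeF; last by left; rewrite eq_sym.
      by apply: add_edgeF => //; left; rewrite // eq_sym.
    by right; rewrite eq_sym.
  have H3ab : H3 a b by rewrite /H3 /H2 /H1 /add_edge Hab.
  pose H4 := del_edge H3 a b.
  have H4s : symmetric H4 by exact: del_edge_sym.
  have H4vx : H4 v x.
    rewrite /H4 /del_edge /H3 /H2 /H1 /add_edge Hvx /=.
    by rewrite (negPf xa) (negPf xb) !andbF.
  exists (del_edge H4 v x); split; first exact: del_edge_sym.
  split=> [c e /del_edgeE/del_edgeE/add_edgeE[/add_edgeE[/add_edgeE[/Hg//|]|]|]|z].
    - by case=> -[-> ->] //; rewrite gs.
    - by case=> -[-> ->] //; rewrite gs.
    - by case=> -[-> ->] //; rewrite gs.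
  have ux : u != x by rewrite eq_sym.
  have vx : v != x by rewrite eq_sym.
  have va : v != a by rewrite eq_sym.
  have vb : v != b by rewrite eq_sym.
  have := deg_del z H4s vx H4vx; have := deg_del z H3s ab H3ab.
  rewrite (deg_add z H2s vb nH2) (deg_add z H1s va nH1) (deg_add z Hs ux nHux).
  rewrite -[del_edge H3 a b]/H4; move: (Hdeg z); clear; lia.
have noBB a b : a \in B -> b \in B -> H a b = false.
  move=> aB bB; apply: contraNF noE2 => Hab.
  by apply/exists_inP; exists a => //; apply/exists_inP; exists b.
(* Now [B] is also independent in [H], so its [H]-neighbours lie in [Z'] or equal [u], and the count
   is repeated with the roles of [u] and [v] exchanged. *)
pose Z' := ~: (u |: (v |: (A :|: B))).
have cardZ' : #|Z'| + 2 + #|A :|: B| = #|T|.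
  rewrite -(cardsC Z') /Z' setCK !cardsU1 !in_setU !in_set1.
  by rewrite (negPf uv) (negPf uA) (negPf uB) (negPf vA) (negPf vB) /=; clear; lia.
have := cardsUI A B => cUI.
have count2 : k * #|B| + #|[set z in Z' | H v z]| + #|[set z in Z' | H u z]|
    <= k * #|Z'| + #|[set x in B | H u x]|.
  apply: count_nbrs => //.
  - by move=> y; rewrite inE => /andP[/gv[yu yv] _]; apply: Hk.
  - by move=> z; rewrite !inE !negb_or => /andP[zu /andP[zv _]]; apply: Hk.
  - move=> y z yB Hyz; case: (eqVneq z u) => [|zu]; [by right|left].
    rewrite !in_setC !in_setU !in_set1 (negPf zu) /=; apply/norP; split.
      by apply/eqP => E; move: yB; rewrite inE -E Hs Hyz andbF.
    apply/norP; split; apply/negP => zX; move: Hyz.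
      by rewrite Hs (noAB z y).
    by rewrite (noBB y z).
have leBu : #|[set x in B | H u x]| <= k.-1.
  by rewrite -degu; apply: subset_leq_card; apply/subsetP => z; rewrite !inE => /andP[].
(* [#|Z'|] is at most [#|A :&: B|], and the error term in [count2] is below [k], so [B] lies in [A].
   Then [u] has no [H]-neighbour in [B] and all its [k - 1] in [Z'], which makes [count2]
   impossible. *)
have cI : #|A :&: B| = #|B|.
  have leI : #|A :&: B| <= #|B| by rewrite subset_leq_card ?subsetIr.
  have le1 : #|Z'| <= #|A :&: B| by clear -cardZ' cUI cA cB dsum k2; lia.
  have le2 : k * #|Z'| <= k * #|A :&: B| by rewrite leq_mul2l le1 orbT.
  apply/eqP; rewrite eqn_leq leI leqNgt; apply/negP => lt.
  have : k * (#|A :&: B|.+1) <= k * #|B| by rewrite leq_mul2l lt orbT.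
  by clear -count2 leBu le2 k0; lia.
have sBA : B \subset A.
  apply/setIidPr/eqP; by rewrite eqEcard subsetIr cI /=.
have Bu0 : #|[set x in B | H u x]| = 0.
  apply/eqP; rewrite cards_eq0; apply/eqP/setP => z; rewrite in_set0 in_set.
  by apply/negP => /andP[/(subsetP sBA)]; rewrite inE => /andP[_ /negPf->].
have : #|[set z in Z' | H u z]| = k.-1.
  rewrite -degu /deg; apply: eq_card => z.
  rewrite !(in_set, in_setC, in_setU, in_set1).
  case: (boolP (H u z)) => [Huz|]; rewrite ?andbF //= !andbT.
  have [/negPf-> /negPf->] := gu z (Hg _ _ Huz).
  apply/negP => zB; have : z \in A by apply: (subsetP sBA); rewrite in_set.
  by rewrite in_set Huz andbF.
have leZB : #|Z'| <= #|B| by clear -cardZ' cUI cI cA cB dsum k2; lia.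
have : k * #|Z'| <= k * #|B| by rewrite leq_mul2l leZB orbT.
by clear -count2 Bu0 k2; lia.
Qed.

End Stab.

(** * Closures and clique counts *)

Section Closure.
Variable T : finType.
Implicit Types (g h F : rel T) (u v x y : T) (A B D Z : {set T}).

Lemma closure_simple l g h : simple_graph g -> closure_reach l g h -> simple_graph h.
Proof.
move=> gP; elim=> // h' u v _ [hi hs] uv _ _.
by split; [exact: add_edge_irr | exact: add_edge_sym].
Qed.

Lemma closure_sub l g h x y : closure_reach l g h -> g x y -> h x y.
Proof. by elim=> // h' u v _ IH _ _ _ /IH; rewrite /add_edge => ->. Qed.

Lemma closure_exists l g : simple_graph g -> exists h, is_closure l g h.
Proof.
move=> gP; rewrite /is_closure.
apply: (@augment T (closure_reach l g)
  (fun h => forall u v, u != v -> ~~ h u v -> deg h u + deg h v < l) _ g); last exact: CR0.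
move=> h hP; have [hi hs] := closure_simple gP hP.
case: (boolP [exists u, exists v, [&& u != v, ~~ h u v & l <= deg h u + deg h v]]).
  case/existsP => u /existsP[v /and3P[uv nh le]]; right.
  exists (add_edge h u v); split; first exact: CRS.
  apply: (@sum_deg_lt _ _ _ u) => [x|]; rewrite deg_add //; first lia.
  by rewrite eqxx (negPf uv); lia.
move=> no; left=> u v uv nh; rewrite ltnNge; apply: contra no => le.
by apply/existsP; exists u; apply/existsP; exists v; rewrite uv nh.
Qed.

(** The added edges are undone one at a time. The threshold is [#|T| - 1] for [k = 1] and
    [#|T| + 2 * k - 4] for larger [k]. *)
Lemma kfactor_closure l k g h : simple_graph g -> 0 < k ->
  #|T| + (if k == 1 then 0 else 2 * k - 3) - 1 <= l ->
  closure_reach l g h -> has_kfactor h k -> has_kfactor g k.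
Proof.
move=> gP k0 le_l; elim=> // h' u v hP IH uv nh le hk; apply: IH.
apply: (kfactor_add_edge (closure_simple gP hP) k0 uv nh) hk; lia.
Qed.

Lemma is_cliqueP g (S : {set T}) :
  reflect (forall x y, x \in S -> y \in S -> x != y -> g x y) (is_clique g S).
Proof.
apply: (iffP forall_inP) => [H x y xS yS|H x xS].
  by move/forall_inP: (H x xS) => /(_ y yS)/implyP.
by apply/forall_inP => y yS; apply/implyP; exact: H.
Qed.

Lemma Nr_mono g h r : (forall x y, g x y -> h x y) -> Nr g r <= Nr h r.
Proof.
move=> gh; apply: subset_leq_card; apply/subsetP => S; rewrite !inE => /andP[/is_cliqueP gS ->].
by rewrite andbT; apply/is_cliqueP => x y xS yS xy; apply/gh/gS.
Qed.

(** Deleting [x] maps these cliques injectively to [r.-1]-subsets of its neighbourhood. *)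
Lemma cliques_at g x r : 0 < r ->
  #|[set S : {set T} | [&& is_clique g S, #|S| == r & x \in S]]| <= 'C(deg g x, r.-1).
Proof.
move=> r0; rewrite /deg -cards_draws -(card_in_imset (f := fun S => S :\ x)); last first.
  move=> S S'; rewrite !inE => /and3P[_ _ xS] /and3P[_ _ xS'] E.
  by rewrite -(setD1K xS) -(setD1K xS') E.
apply: subset_leq_card; apply/subsetP => X /imsetP[S]; rewrite inE => /and3P[/is_cliqueP gS /eqP cS xS] ->{X}.
rewrite inE; apply/andP; split; last by rewrite -cS (cardsD1 x S) xS.
apply/subsetP => y; rewrite !inE => /andP[yx yS]; apply: gS => //.
by rewrite eq_sym.
Qed.

(** An [r]-clique either avoids [D] or passes through one of its vertices; the latter are estimated
    by a union bound. *)
Lemma Nr_low_degree g D r q : 0 < r -> (forall x, x \in D -> deg g x <= q) ->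
  Nr g r <= 'C(#|T| - #|D|, r) + #|D| * 'C(q, r.-1).
Proof.
move=> r0 degD.
pose K x := [set S : {set T} | [&& is_clique g S, #|S| == r & x \in S]].
have sub : [set S : {set T} | is_clique g S & #|S| == r] \subset
   [set S : {set T} | S \subset ~: D & #|S| == r] :|: \bigcup_(x in D) K x.
  apply/subsetP => S; rewrite !inE => /andP[cl cS]; rewrite cS andbT.
  case: (boolP (S \subset ~: D)) => //= /subsetPn[x xS]; rewrite inE negbK => xD.
  by apply/bigcupP; exists x; rewrite // inE cl cS xS.
apply: leq_trans (subset_leq_card sub) _; apply: leq_trans (leq_card_setU _ _) _.
rewrite cards_draws cardsCs setCK leq_add2l.
have le_card (I : {set T}) (G : T -> {set {set T}}) : #|\bigcup_(x in I) G x| <= \sum_(x in I) #|G x|.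
  elim/big_rec2: _ => [|x n X _ IH]; first by rewrite cards0.
  by apply: leq_trans (leq_card_setU _ _) _; rewrite leq_add2l.
apply: leq_trans (le_card _ _) _; rewrite -sum_nat_const; apply: leq_sum => x xD.
by apply: leq_trans (cliques_at g x r0) _; apply: leq_bin2l; exact: degD.
Qed.

End Closure.

(** * Convexity of the clique bound *)

(** Common form of [varphi] and [phi]: the bound of [Nr_low_degree] for [n + q - l] vertices of
    degree at most [q] in a graph of order [n]. *)
Definition psi (n l r q : nat) := 'C(l - q, r) + (n + q - l) * 'C(q, r.-1).

Lemma varphiE n r q : 0 < n -> varphi n r q = psi n (n - 1) r q.
Proof.
by move=> n0; rewrite /varphi /psi; congr ('C(_, _) + _ * _); lia.
Qed.

Lemma phiE n r k q : 3 < n + 2 * k -> phi n r k q = psi n (n + 2 * k - 4) r q.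
Proof.
by move=> n0; rewrite /phi /psi; congr ('C(_, _) + _ * _); lia.
Qed.

Lemma bin_convex m r : 'C(m.+1, r) * 2 <= 'C(m, r) + 'C(m.+2, r).
Proof.
case: r => [|r]; first by rewrite !bin0.
rewrite (binS m.+1) (binS m).
suff : 'C(m, r) <= 'C(m.+1, r) by lia.
by apply: leq_bin2l; lia.
Qed.

(** The first summand is a reflected binomial, hence convex; the second is an increasing linear
    factor times a nondecreasing convex binomial. *)
Lemma psi_convex n l r q : l <= n + q -> q.+2 <= l ->
  psi n l r q.+1 * 2 <= psi n l r q + psi n l r q.+2.
Proof.
move=> h1 h2; rewrite /psi.
have -> : l - q = (l - q.+2).+2 by lia.
have -> : l - q.+1 = (l - q.+2).+1 by lia.
have := bin_convex (l - q.+2) r.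
have := bin_convex q r.-1.
have : 'C(q.+1, r.-1) <= 'C(q.+2, r.-1) by apply: leq_bin2l.
have -> : n + q.+2 - l = (n + q - l).+2 by lia.
have -> : n + q.+1 - l = (n + q - l).+1 by lia.
move: ('C(q, _)) ('C(q.+1, r.-1)) ('C(q.+2, r.-1)) (n + q - l) => a b c s. nia.
Qed.

Lemma convex_max (f : nat -> nat) a b q :
  (forall p, a <= p -> p.+2 <= b -> f p.+1 * 2 <= f p + f p.+2) ->
  a <= q <= b -> f q <= maxn (f a) (f b).
Proof.
move=> cvx /andP[aq qb]; have [m bE] : exists m, b = a + m by exists (b - a); lia.
elim: m a bE cvx aq => [|m IH] a bE cvx aq.
  have -> : q = a by lia.
  exact: leq_maxl.
case: (eqVneq q a) => [->|ne]; first exact: leq_maxl.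
case: (leqP (f a) (f a.+1)) => [inc|dec].
  have incr j : a + j < b -> f (a + j) <= f (a + j).+1.
    elim: j => [|j IHj] jb; first by rewrite addn0.
    have := cvx (a + j); have := IHj; rewrite addnS in jb *; lia.
  suff H j : q + j <= b -> f q <= f (q + j).
    apply: leq_trans (leq_maxr _ _); have := H (b - q); rewrite subnKC //; exact.
  elim: j => [|j IHj]; first by rewrite addn0.
  rewrite addnS => le; apply: leq_trans (IHj _) _; first lia.
  by have := incr (q + j - a); rewrite subnKC //; lia.
have le1 : f q <= maxn (f a.+1) (f b).
  by apply: IH => [|p ap|]; [|apply: cvx|]; lia.
by apply: leq_trans le1 _; rewrite geq_max !leq_max leqnn (ltnW dec) orbT.
Qed.

(** * Dense closed graphs *)

Section Structure.
Variables (T : finType) (n : nat).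
Hypothesis cardT : #|T| = n.
Implicit Types (g h F : rel T) (u v x y : T) (A B D Z : {set T}).

Lemma Nr_psi h D l r q : 0 < r -> l <= n + q -> q <= l ->
  n + q - l <= #|D| -> (forall x, x \in D -> deg h x <= q) ->
  Nr h r <= psi n l r q.
Proof.
move=> r0 le1 le2 cD degD; have [B sBD cB] := ex_subset_card cD.
have := @Nr_low_degree T h B r q r0; rewrite cB cardT /psi.
have -> : n - (n + q - l) = l - q by lia.
by apply=> x xB; apply/degD/(subsetP sBD).
Qed.

Lemma high_degree_clique h l delta r : simple_graph h -> 0 < r ->
  (forall u v, u != v -> ~~ h u v -> deg h u + deg h v < l) ->
  l <= n + delta ->
  (forall q, delta < q -> q.*2 < l -> psi n l r q < Nr h r) ->
  forall x y, x != y -> delta < deg h x -> delta < deg h y -> h x y.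
Proof.
move=> [hi hs] r0 cl len big x y xy dx dy; apply: contraT => nhxy.
pose P (p : T * T) := [&& p.1 != p.2, ~~ h p.1 p.2, delta < deg h p.1 & delta < deg h p.2].
pose f (p : T * T) := deg h p.1 + deg h p.2.
have P0 : P (x, y) by rewrite /P /= xy nhxy dx dy.
(* A pair of maximal degree sum is chosen; by symmetry its first vertex may be taken to have the
   smaller degree. *)
suff main u v : P (u, v) -> (forall p, P p -> f p <= f (u, v)) -> deg h u <= deg h v -> False.
  case: (arg_maxnP f P0) => -[u v] Puv max.
  case: (leqP (deg h u) (deg h v)) => [le|/ltnW le].
    by case: (main u v).
  case: (main v u) => //.
    by move: Puv; rewrite /P /= eq_sym hs; case/and4P => -> -> -> ->.
  by move=> p Pp; have := max p Pp; rewrite /f /= [deg h v + _]addnC.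
case/and4P=> /= uv nhuv du dv max le.
have sumlt := cl u v uv nhuv.
(* From [deg h u + deg h v < l], the non-neighbours of [v] number at least [n + deg h u - l]. Each
   has degree at most [delta], or at most [deg h u] by maximality of the pair. *)
pose Z := ~: (v |: [set z | h v z]).
have cZ : #|Z| + deg h v + 1 = n.
  by rewrite -cardT -(cardsC Z) setCK cardsU1 inE hi /=; clear; rewrite /deg; lia.
have := big (deg h u) du _; rewrite -addnn => /(_ (leq_ltn_trans (leq_add (leqnn _) le) sumlt)).
rewrite ltnNge => /negP; apply; apply: (@Nr_psi _ Z) => //; try by clear -len du le sumlt cZ; lia.
move=> z; rewrite !inE negb_or => /andP[zv nvz].
case: (leqP (deg h z) delta) => [|dz]; first by move/leq_trans; apply; exact: ltnW.
suff : f (z, v) <= f (u, v) by rewrite leq_add2r.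
by apply: max; rewrite /P /= zv dz dv hs nvz.
Qed.

Lemma closed_structure h (l delta r : nat) (D := [set x | deg h x == delta]) :
  simple_graph h -> 0 < r ->
  (forall u v, u != v -> ~~ h u v -> deg h u + deg h v < l) ->
  (forall x, delta <= deg h x) ->
  l <= n + delta -> delta.*2 < l ->
  psi n l r delta.+1 < Nr h r ->
  (forall q, delta < q -> q.*2 < l -> psi n l r q < Nr h r) ->
  (forall x y, x \notin D -> y \notin D -> x != y -> h x y) /\
  (D != set0 -> #|D| + l = n + delta /\
     forall x, x \notin D ->
       (forall y, y \in D -> h x y) \/ (forall y, y \in D -> ~~ h x y)).
Proof.
move=> hP r0 cl mind len dl big1 big; have [hi hs] := hP.
have clq x y : x \notin D -> y \notin D -> x != y -> h x y.
  rewrite !inE => nx ny xy.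
  by apply: (high_degree_clique hP r0 cl len big); rewrite // ltn_neqAle eq_sym ?nx ?ny mind.
split=> // Dn0.
have c1 : #|D| + #|~: D| = n by rewrite cardsC.
(* A larger [D] would supply enough vertices of degree at most [delta.+1] to contradict [big1]. *)
have cD : #|D| + l <= n + delta.
  rewrite leqNgt; apply/negP => lt; move: big1; rewrite ltnNge => /negP; apply.
  apply: (@Nr_psi _ D) => //; try by clear -len dl lt; lia.
  by move=> x; rewrite inE => /eqP->.
have key x y : x \notin D -> y \in D -> ~~ h x y ->
    #|D| + l = n + delta /\ forall z, z \in D -> ~~ h x z.
  move=> xD yD nxy; have xy : x != y by apply: contraNneq xD => ->.
  have := cl x y xy nxy; have /eqP-> : deg h y == delta by rewrite inE in yD.
  move=> lt.
  (* Outside [D] the graph is a clique, so [x] already has degree [n - #|D| - 1] there. Closedness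
     at the pair [x], [y] then forces equality in [cD] and leaves [x] no neighbour in [D]. *)
  have dx : deg h x = #|[set z in D | h x z]| + #|~: D :\ x|.
    rewrite /deg -(cardsID D [set z | h x z]); congr addn.
      by apply: eq_card => z; rewrite !inE andbC.
    apply: eq_card => z; rewrite !(in_setD, in_set, in_setC, in_set1).
    case: (eqVneq z x) => [->|zx]; first by rewrite hi andbF.
    rewrite andTb; case: (boolP (z \in D)) => zD.
      by move: zD; rewrite inE => ->.
    by move: (zD); rewrite inE => ->; rewrite clq // eq_sym.
  have := cardsD1 x (~: D); rewrite in_setC xD /= => c2.
  have e0 : #|[set z in D | h x z]| = 0 by clear -dx c1 c2 lt cD; lia.
  split; first by clear -dx c1 c2 lt cD; lia.
  move=> z zD; apply/negP => hxz; have := cards0_eq e0 => /setP/(_ z).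
  by rewrite in_set0 in_set zD hxz.
split.
  case/set0Pn: Dn0 => y yD.
  case: (pickP [pred x | (x \notin D) && ~~ h x y]) => [x /andP[xD nxy]|no].
    by have [] := key x y xD yD nxy.
  (* If all outside vertices were adjacent to [y], then [n - #|D| <= delta]; with [cD] this gives
     [l <= delta.*2], which is excluded. *)
  have : #|~: D| <= deg h y.
    apply: subset_leq_card; apply/subsetP => x; rewrite in_setC => xD.
    by have := no x; rewrite /= xD hs => /negbFE; rewrite inE.
  have /eqP-> : deg h y == delta by rewrite inE in yD.
  by clear -cD dl c1; lia.
move=> x xD; case: (pickP [pred y | (y \in D) && ~~ h x y]) => [y /andP[yD nxy]|no].
  by right; have [] := key x y xD yD nxy.
by left=> y yD; have := no y; rewrite /= yD => /negbFE.
Qed.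

End Structure.

(** * Graphs with prescribed degrees *)

Section Factors.
Variable T : finType.
Implicit Types (g h F : rel T) (u v x y : T) (A B C D Z : {set T}).

Lemma sum_deg_incr F F' u v : (forall z, deg F' z = deg F z + (z == u) + (z == v)) ->
  \sum_x deg F x < \sum_x deg F' x.
Proof.
move=> E; apply: (@sum_deg_lt _ _ _ u) => [x|]; rewrite E; first lia.
by rewrite eqxx; lia.
Qed.

(** A graph with degrees at most [f] is augmented. Since more than [k] vertices have the full demand
    [k], a deficient vertex always has a non-neighbour among them, which serves as the pivot of a
    switch. *)
Lemma graphic (f : T -> nat) k : (forall x, f x <= k) -> ~~ odd (\sum_x f x) ->
  k < #|[set x | f x == k]| ->
  exists F, [/\ symmetric F, irreflexive F & forall x, deg F x = f x].
Proof.
move=> fk evf cK; set K := [set x | f x == k] in cK.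
pose P F := [/\ symmetric F, irreflexive F & forall x, deg F x <= f x].
have P0 : P (fun _ _ => false).
  by split=> // x; rewrite /deg (_ : [set y | false] = set0) ?cards0 //; apply/setP => y; rewrite !inE.
have [|F [[Fs Fi _] FE]] := @augment T P (fun F => forall x, deg F x = f x) _ _ P0; last by exists F.
move=> F [Fs Fi Fle].
case: (boolP [forall x, deg F x == f x]) => [/forallP eqF|].
  by left=> x; apply/eqP.
case/forallPn => u neq_u; right.
have ltu : deg F u < f u by rewrite ltn_neqAle neq_u Fle.
have uptodeg F' w v : symmetric F' -> irreflexive F' ->
    (forall z, deg F' z = deg F z + (z == w) + (z == v)) ->
    deg F w + (w == v) < f w -> deg F v < f v ->
    exists F', P F' /\ \sum_x deg F x < \sum_x deg F' x.
  move=> F's F'i E ltw ltv; exists F'; split; last exact: sum_deg_incr E.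
  split=> // z; rewrite E; case: (eqVneq z w) => [->|zw]; first by clear -ltw; lia.
  by case: (eqVneq z v) => [->|zv]; rewrite ?addn0 ?addn1.
have fresh w : deg F w < k -> exists x, [/\ x \in K, x != w & ~~ F w x].
  move=> ltw; case: (pickP [pred x | [&& x \in K, x != w & ~~ F w x]]) => [x /and3P[]|no].
    by exists x.
  have : K \subset w |: [set x | F w x].
    apply/subsetP => x xK; have := no x; rewrite /= xK !inE /=.
    by case: eqP => //= _ /negbFE.
  by move/subset_leq_card; rewrite cardsU1 inE Fi -/(deg F w); clear -ltw cK; lia.
have ltuk : deg F u < k := leq_trans ltu (fk u).
case: (pickP [pred v | (v != u) && (deg F v < f v)]) => [v /andP[vu ltv]|sat].
  have uv : u != v by rewrite eq_sym.
  have addnew w w' : w != w' -> ~~ F w w' -> deg F w < f w -> deg F w' < f w' ->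
      exists F', P F' /\ \sum_x deg F x < \sum_x deg F' x.
    move=> ww' nF l l'; apply: (uptodeg (add_edge F w w') w w') => //.
    - exact: add_edge_sym.
    - exact: add_edge_irr.
    - by move=> z; rewrite deg_add.
    - by rewrite (negPf ww') addn0.
  case: (boolP (F u v)) => Fuv; last exact: (addnew u v).
  have ltvk : deg F v < k := leq_trans ltv (fk v).
  have [x [xK xu nux]] := fresh u ltuk; have ux : u != x by rewrite eq_sym.
  have fx : f x = k by move: xK; rewrite inE => /eqP.
  have := Fle x; rewrite leq_eqVlt => /orP[/eqP degx|ltx]; last exact: (addnew u x).
  have xv : x != v by apply: contraNneq nux => ->.
  (* [u] is a neighbour of [v] but not of [x], so removing it costs nothing and brings the size down
     to [deg F v < k = deg F x]. Hence [x] has a neighbour outside the closed neighbourhood of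
     [v]. *)
  have lt : #|(v |: [set y | F v y]) :\ u| < deg F x.
    have := cardsD1 u (v |: [set y | F v y]); rewrite cardsU1 !inE Fi Fs Fuv orbT -/(deg F v).
    by rewrite degx fx; clear -ltvk; lia.
  have [y Fxy] := ex_nbr_out lt.
  rewrite !inE negb_and negbK negb_or => /orP[/eqP yu|/andP[yv nvy]].
    by rewrite yu Fs (negPf nux) in Fxy.
  have vy : v != y by rewrite eq_sym.
  have xy : x != y by apply: contraTneq Fxy => ->; rewrite Fi.
  apply: (uptodeg (switch F u x y v) u v) => //.
  - exact: switch_sym.
  - exact: switch_irr.
  - by move=> z; rewrite switch_deg //; right.
  - by rewrite (negPf uv) addn0.
have satE v : v != u -> deg F v = f v.
  by move=> vu; have := sat v; rewrite /= vu /= ltn_neqAle Fle andbT => /negbFE/eqP.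
(* Only [u] is deficient, so by parity it lacks at least two, and a switch with both ends at [u]
   applies. *)
have ltu2 : (deg F u).+1 < f u.
  rewrite ltn_neqAle ltu andbT; apply: contra evf => /eqP E.
  have := sum_deg_even Fs Fi; rewrite (bigD1 u) //= [in X in _ -> is_true X](bigD1 u) //= -E.
  under eq_bigr => v vu do rewrite (satE v vu).
  by rewrite addSn /= => /negPf->.
have [x [xK xu nux]] := fresh u ltuk; have ux : u != x by rewrite eq_sym.
have fx : f x = k by move: xK; rewrite inE => /eqP.
have lt : #|u |: [set y | F u y]| < deg F x.
  rewrite satE // fx cardsU1 inE Fi -/(deg F u).
  by have := leq_trans ltu2 (fk u); clear; lia.
have [y Fxy] := ex_nbr_out lt.
rewrite !inE negb_or => /andP[yu nuy].
have uy : u != y by rewrite eq_sym.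
have xy : x != y by apply: contraTneq Fxy => ->; rewrite Fi.
apply: (uptodeg (switch F u x y u) u u) => //.
- exact: switch_sym.
- exact: switch_irr.
- by move=> z; rewrite switch_deg //; left.
- by rewrite eqxx addn1.
Qed.

(** [graphic] realises the residual degrees [k - deg F x]. These vanish on [D], so the new graph
    lives in the clique outside [D] and shares no edge with [F], all of whose edges meet [D]. *)
Lemma kfactor_finish h D F k : simple_graph h ->
  (forall x y, x \notin D -> y \notin D -> x != y -> h x y) ->
  symmetric F -> (forall x y, F x y -> h x y) ->
  (forall x y, F x y -> (x \in D) || (y \in D)) ->
  (forall x, x \in D -> deg F x = k) -> (forall x, deg F x <= k) ->
  k < #|[set x | (x \notin D) && (deg F x == 0)]| -> ~~ odd (#|T| * k) ->
  has_kfactor h k.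
Proof.
move=> [hi hs] clq Fs Fh FD degD degk big ev.
have Fi : irreflexive F by move=> x; apply/negP => /Fh; rewrite hi.
have [| | |G [Gs Gi Gdeg]] := @graphic (fun x => k - deg F x) k.
- by move=> x; exact: leq_subr.
- have : \sum_x (k - deg F x) + \sum_x deg F x = #|T| * k.
    rewrite -big_split /= -sum_nat_const; apply: eq_bigr => x _; exact: subnK.
  move=> E; move: ev; rewrite -E oddD; have := sum_deg_even Fs Fi.
  by move=> /negPf->; rewrite addbF.
- apply: leq_trans big _; apply: subset_leq_card; apply/subsetP => x.
  by rewrite !inE => /andP[_ /eqP->]; rewrite subn0.
have GD x y : G x y -> x \notin D.
  move=> Gxy; apply/negP => xD; have := Gdeg x; rewrite degD // subnn => /eqP.
  by rewrite eqn0Ngt; case/negP; apply/deg_gt0P; exists y.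
exists (fun x y => F x y || G x y); split; first by move=> x y; rewrite Fs Gs.
split=> [x y /orP[/Fh//|Gxy]|x].
  apply: clq; [exact: GD Gxy | by apply: (GD y x); rewrite Gs |].
  by apply: contraTneq Gxy => ->; rewrite Gi.
rewrite -[RHS](subnKC (degk x)) -Gdeg !deg_sum -big_split /=; apply: eq_bigr => y _.
case: (boolP (G x y)) => Gxy; rewrite ?orbF ?addn0 // orbT.
case: (boolP (F x y)) => // /FD; rewrite (negPf (GD x y Gxy)).
by rewrite (negPf (GD y x _)) // Gs.
Qed.

(** A bipartite transport with row demands [k - deg F0 y] and column capacities [k]. Each single
    demand fits into [C] and the total fits the capacity; an obstructed augmentation is rerouted by
    a switch. *)
Lemma distribute h D C F0 k : simple_graph h ->
  (forall x y, x \in D -> y \in C -> h x y) -> [disjoint D & C] ->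
  symmetric F0 -> (forall x y, F0 x y -> [&& h x y, x \in D & y \in D]) ->
  (forall x, deg F0 x <= k) ->
  (forall y, y \in D -> k <= #|C| + deg F0 y) ->
  \sum_(y in D) (k - deg F0 y) <= k * #|C| ->
  exists F, [/\ symmetric F, forall x y, F x y -> h x y,
    forall x y, F x y -> (x \in D) && (y \in D :|: C) || (y \in D) && (x \in D :|: C),
    forall x, x \in D -> deg F x = k & forall x, deg F x <= k].
Proof.
move=> [hi hs] DC dis F0s F0h F0k dem tot.
pose ok x y := (x \in D) && (y \in D :|: C) || (y \in D) && (x \in D :|: C).
pose P F := [/\ symmetric F, forall x y, F x y -> h x y /\ ok x y,
  forall x y, x \in D -> y \in D -> F x y = F0 x y & forall x, deg F x <= k].
have P0 : P F0.
  split=> // x y /F0h/and3P[hxy xD yD]; split=> //.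
  by rewrite /ok !inE xD yD.
have nCD x : x \in C -> x \notin D.
  by move=> xC; apply: contraL xC => xD; rewrite (disjointFr dis xD).
have [|F [[Fs Fh _ Fk] FE]] :=
  @augment T P (fun F => forall x, x \in D -> deg F x = k) _ _ P0; last first.
  by exists F; split=> // x y /Fh[].
move=> F [Fs Fh FF0 Fk].
have Fi x : F x x = false by apply/negP => /Fh[]; rewrite hi.
case: (pickP [pred y | (y \in D) && (deg F y < k)]) => [y /andP[yD lty]|sat]; last first.
  left=> x xD; apply/eqP; rewrite eqn_leq Fk leqNgt; apply/negP => lt.
  by have := sat x; rewrite /= xD lt.
right.
have degE z : z \in D -> deg F z = deg F0 z + #|[set x in C | F z x]|.
  move=> zD; rewrite /deg -(cardsID D [set x | F z x]); congr addn; apply: eq_card => x.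
    rewrite !inE; case: (boolP (x \in D)) => xD; first by rewrite FF0 ?andbT.
    by rewrite andbF; apply/esym/negP => /F0h/and3P[_ _]; rewrite (negPf xD).
  rewrite !inE; case: (boolP (F z x)) => Fzx; rewrite ?andbF //= !andbT.
  case: (boolP (x \in C)) => xC; first by rewrite nCD.
  by have [_] := Fh _ _ Fzx; rewrite /ok !inE zD (negPf xC) orbF; case: (x \in D).
have [x xC nyx] : exists2 x, x \in C & ~~ F y x.
  case: (pickP [pred x | (x \in C) && ~~ F y x]) => [x /andP[]|no]; first by exists x.
  have : C \subset [set x in C | F y x].
    by apply/subsetP => x xC; have := no x; rewrite /= !inE xC /= => /negbFE.
  by move/subset_leq_card; have := degE y yD; have := dem y yD; clear -lty; lia.
have yx : y != x by apply: contraTneq yD => ->; exact: nCD.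
have okDC a b : a \in D -> b \in C -> [/\ h a b, h b a, ok a b & ok b a].
  by move=> aD bC; rewrite (hs b a) (DC a b aD bC) /ok !inE aD bC !orbT.
have addnew z : z \in C -> deg F z < k -> ~~ F y z ->
    exists F', P F' /\ \sum_x deg F x < \sum_x deg F' x.
  move=> zC ltz nyz; have yz : y != z by apply: contraTneq yD => ->; exact: nCD.
  have degF' w := deg_add w Fs yz nyz.
  exists (add_edge F y z); split; last exact: sum_deg_incr degF'.
  split; first exact: add_edge_sym.
  - have [h1 h2 o1 o2] := okDC y z yD zC.
    by move=> a b /add_edgeE[/Fh//|[] [-> ->]].
  - move=> a b aD bD; rewrite /add_edge -FF0 //.
    have -> : (b == z) = false by apply: contraTF bD => /eqP->; exact: nCD.
    have -> : (a == z) = false by apply: contraTF aD => /eqP->; exact: nCD.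
    by rewrite andbF !orbF.
  move=> w; rewrite degF'; case: (eqVneq w y) => [->|wy].
    by rewrite (negPf yz) addn0 addn1.
  by case: (eqVneq w z) => [->|wz]; rewrite ?addn0 ?addn1.
have := Fk x; rewrite leq_eqVlt => /orP[/eqP degx|ltx]; last exact: (addnew x).
(* If all of [C] were full, [k * #|C|] edges would reach [D], but the deficit at [y] keeps their
   number below the total demand. *)
have [x' x'C ltx'] : exists2 x', x' \in C & deg F x' < k.
  case: (pickP [pred x | (x \in C) && (deg F x < k)]) => [z /andP[]|no]; first by exists z.
  have s1 : k * #|C| <= \sum_(z in C) #|[set w in D | F z w]|.
    rewrite mulnC -sum_nat_const; apply: leq_sum => z zC.
    have -> : #|[set w in D | F z w]| = deg F z.
      apply: eq_card => w; rewrite !inE andbC; case: (boolP (F z w)) => //= /Fh[_].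
      by rewrite /ok (negPf (nCD z zC)) /= => /andP[].
    by rewrite leqNgt; have := no z; rewrite /= zC => /= ->.
  rewrite (double_count _ _ Fs) in s1.
  have : \sum_(w in D) #|[set z in C | F w z]| < \sum_(w in D) (k - deg F0 w).
    rewrite (bigD1 y) //= [X in _ < X](bigD1 y) //= -addSn; apply: leq_add.
      by have := degE y yD; clear -lty; lia.
    apply: leq_sum => w /andP[wD _]; have := degE w wD; have := Fk w; clear; lia.
  by move=> lt; have := leq_trans lt tot; rewrite ltnNge s1.
case: (boolP (F y x')) => Fyx'; last exact: (addnew x').
have lt : #|[set w | F x' w]| < deg F x by rewrite degx.
have [y' Fxy'] := ex_nbr_out lt; rewrite inE => nx'y'.
have y'D : y' \in D.
  by have [_] := Fh _ _ Fxy'; rewrite /ok (negPf (nCD x xC)) /= => /andP[].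
have yx' : y != x' by apply: contraTneq yD => ->; exact: nCD.
have x'y' : x' != y' by apply: contraTneq y'D => <-; exact: nCD.
have xy' : x != y' by apply: contraTneq y'D => <-; exact: nCD.
have yy' : y != y' by apply: contraNneq nyx => ->; rewrite Fs.
have degF' w : deg (switch F y x y' x') w = deg F w + (w == y) + (w == x').
  by apply: switch_deg => //; left.
exists (switch F y x y' x'); split; last exact: sum_deg_incr degF'.
split; first exact: switch_sym.
- have [h1 h2 o1 o2] := okDC y x yD xC; have [h3 h4 o3 o4] := okDC y' x' y'D x'C.
  by move=> a b /switchE[/Fh//|[] [-> ->]|[] [-> ->]].
- move=> a b aD bD; rewrite /switch /del_edge /add_edge -FF0 //.
  have nC c z : c \in D -> z \in C -> (c == z) = false.
    by move=> cD zC; apply: contraTF cD => /eqP->; exact: nCD.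
  by rewrite !(nC _ x) // !(nC _ x') // !andbF !orbF andbT.
move=> w; rewrite degF'; case: (eqVneq w y) => [->|wy].
  by rewrite (negPf yx') addn0 addn1.
by case: (eqVneq w x') => [->|wz]; rewrite ?addn0 ?addn1.
Qed.

End Factors.

(** * Extending a factor of the low-degree part *)

Section Extend.
Variable T : finType.
Implicit Types (g h F : rel T) (u v x y : T) (A B C D Z : {set T}).

Lemma deg_eq0 F x : (forall y, ~~ F x y) -> deg F x = 0.
Proof.
by move=> no; apply/eqP; rewrite eqn0Ngt; apply/negP => /deg_gt0P[y]; apply/negP.
Qed.

(** [distribute] completes the degrees on [D], then [kfactor_finish] those outside; the vertices
    beyond [D :|: C] are untouched by the first stage and supply the more than [k] full demands of
    the second. *)
Lemma kfactor_extend h D C F0 k : simple_graph h ->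
  (forall x y, x \notin D -> y \notin D -> x != y -> h x y) ->
  (forall x y, x \in D -> y \in C -> h x y) -> [disjoint D & C] ->
  symmetric F0 -> (forall x y, F0 x y -> [&& h x y, x \in D & y \in D]) ->
  (forall x, deg F0 x <= k) ->
  (forall y, y \in D -> k <= #|C| + deg F0 y) ->
  \sum_(y in D) (k - deg F0 y) <= k * #|C| ->
  k < #|~: (D :|: C)| -> ~~ odd (#|T| * k) ->
  has_kfactor h k.
Proof.
move=> hP clq DC dis F0s F0h F0k dem tot big ev.
have [F [Fs Fh Fok FD Fk]] := distribute hP DC dis F0s F0h F0k dem tot.
apply: (kfactor_finish (D := D) (F := F)) => //.
  by move=> x y /Fok/orP[] /andP[->]; rewrite ?orbT.
apply: leq_trans big _; apply: subset_leq_card; apply/subsetP => x.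
rewrite !inE negb_or => /andP[xD xC]; rewrite xD; apply/eqP/deg_eq0 => y.
apply/negP => /Fok; rewrite !inE (negPf xD) (negPf xC) /=.
by rewrite andbF.
Qed.

Lemma complete_kfactor h k : simple_graph h -> (forall x y, x != y -> h x y) ->
  k < #|T| -> ~~ odd (#|T| * k) -> has_kfactor h k.
Proof.
move=> hP clq lt ev.
apply: (@kfactor_extend h set0 set0 (fun _ _ => false)) => //.
- by move=> x y _ _; exact: clq.
- by move=> x y; rewrite inE.
- by rewrite disjoints_subset sub0set.
- by move=> x; rewrite deg_eq0.
- by move=> y; rewrite inE.
- by rewrite big_set0.
- by rewrite setU0 setC0 cardsT.
Qed.

Lemma saturated_subgraph h D k : simple_graph h ->
  exists F, [/\ symmetric F, forall x y, F x y -> [&& h x y, x \in D & y \in D],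
    forall x, deg F x <= k &
    forall x y, x \in D -> y \in D -> h x y -> deg F x < k -> deg F y < k -> F x y].
Proof.
move=> [hi hs].
pose P F := [/\ symmetric F, forall x y, F x y -> [&& h x y, x \in D & y \in D]
  & forall x, deg F x <= k].
pose Q F := forall x y, x \in D -> y \in D -> h x y -> deg F x < k -> deg F y < k -> F x y.
have P0 : P (fun _ _ => false) by split=> // x; rewrite deg_eq0.
have [|F [[Fs Fh Fk] FQ]] := @augment T P Q _ _ P0; last by exists F.
move=> F [Fs Fh Fk].
case: (pickP [pred p | [&& p.1 \in D, p.2 \in D, h p.1 p.2, deg F p.1 < k,
   deg F p.2 < k & ~~ F p.1 p.2]]) => [[x y] /= /and5P[xD yD hxy lx /andP[ly nF]]|no].
  right; have xy : x != y by apply: contraTneq hxy => ->; rewrite hi.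
  have E z := deg_add z Fs xy nF.
  exists (add_edge F x y); split; last exact: sum_deg_incr E.
  split; first exact: add_edge_sym.
    by move=> a b /add_edgeE[/Fh//|[] [-> ->]]; rewrite xD yD ?hxy // hs hxy.
  move=> z; rewrite E; case: (eqVneq z x) => [->|zx].
    by rewrite (negPf xy) addn0 addn1.
  by case: (eqVneq z y) => [->|zy]; rewrite ?addn0 ?addn1.
left=> x y xD yD hxy lx ly; have := no (x, y).
by rewrite /= xD yD hxy lx ly /= => /negbFE.
Qed.

(** One deficient vertex [y] suffices: by saturation, its neighbours in [D] that are not joined to
    it by [F] all have full degree. *)
Lemma saturated_sum h F D k m c : 1 < k -> irreflexive h ->
  (forall x, x \in D -> #|[set y in D | h x y]| = m) ->
  (forall x y, F x y -> [&& h x y, x \in D & y \in D]) ->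
  (forall x, deg F x <= k) ->
  (forall x y, x \in D -> y \in D -> h x y -> deg F x < k -> deg F y < k -> F x y) ->
  symmetric F ->
  #|D| + 2 * k = m + c + 4 -> \sum_(x in D) (k - deg F x) <= k * c.
Proof.
move=> k2 hi reg Fh Fk sat Fs cD.
case: (pickP [pred y | (y \in D) && (deg F y < k)]) => [y /andP[yD lty]|all]; last first.
  rewrite big1 // => x xD; apply/eqP; rewrite subn_eq0.
  by have := all x; rewrite /= xD /= ltnNge => /negbFE.
have tot : \sum_(x in D) (k - deg F x) + \sum_(x in D) deg F x = k * #|D|.
  by rewrite -big_split /= mulnC -sum_nat_const; apply: eq_bigr => x _; exact: subnK.
set W := [set z in D | h y z]; set N := [set z | F y z].
have sNW : N \subset W.
  by apply/subsetP => z; rewrite !inE => /Fh/and3P[-> _ ->].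
have cW : #|W :\: N| + deg F y = m.
  by rewrite -(reg y yD) -/W -(cardsID N W) (setIidPr sNW) addnC.
have low : deg F y + (#|W :\: N| * k + #|N| * 1) <= \sum_(x in D) deg F x.
  rewrite (bigD1 y) //= leq_add2l.
  rewrite -!sum_nat_const.
  have e : \sum_(i in W :\: N) k + \sum_(i in N) 1 <= \sum_(i in W) deg F i.
    rewrite [X in _ <= X](big_setID N) /= (setIidPr sNW) addnC; apply: leq_add.
      apply: leq_sum => z; rewrite inE => Fyz; apply/deg_gt0P; exists y; by rewrite Fs.
    apply: leq_sum => z; rewrite !inE => /andP[nF /andP[zD hyz]].
    by rewrite leqNgt; apply: contra nF; exact: sat.
  apply: leq_trans e _; rewrite big_mkcond [X in _ <= X]big_mkcond; apply: leq_sum => z _.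
  rewrite inE; case: ifP => // /andP[zD hyz]; rewrite zD /=.
  by case: eqP => // zy; move: hyz; rewrite zy hi.
move: low; rewrite -[#|N|]/(deg F y) => low.
move: tot cD cW lty k2 low; clear.
move: (deg F y) #|W :\: N| #|D| (\sum_(x in D) _) (\sum_(x in D) _) => j p d s s' tot cD cW lt k2 low.
(* The deficit is at most [k * c + (k - 2) * (j - 2 * k)] over the integers, and [j < k]; writing
   [k = k'.+2] avoids truncated subtraction. *)
have [k' kE] : exists k', k = k'.+2 by exists (k - 2); lia.
subst k m.
have : k'.+2 * d + k'.+2 * (2 * k'.+2) = k'.+2 * (p + j + c + 4) by rewrite -mulnDr cD.
have : k' * j <= k' * k'.+2 by rewrite leq_mul2l; lia.
by clear -tot low; nia.
Qed.

(* In an m-regular graph a maximal matching can miss the bound only if it covers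
   exactly m vertices; all of them are then adjacent to any two unmatched vertices,
   and some matching edge is replaced by two. *)
Lemma regular_matching h D m : simple_graph h -> 0 < m -> m.+1 < #|D| ->
  (forall x, x \in D -> #|[set y in D | h x y]| = m) ->
  exists F, [/\ symmetric F, forall x y, F x y -> [&& h x y, x \in D & y \in D],
    forall x, deg F x <= 1 & m < \sum_(x in D) deg F x].
Proof.
move=> [hi hs] m0 cD reg.
pose P F := [/\ symmetric F, forall x y, F x y -> [&& h x y, x \in D & y \in D]
  & forall x, deg F x <= 1].
have P0 : P (fun _ _ => false) by split=> // x; rewrite deg_eq0.
have [|F [[Fs Fh Fk] FQ]] :=
  @augment T P (fun F => m < \sum_(x in D) deg F x) _ _ P0; last by exists F.
move=> F [Fs Fh Fk].
case: (ltnP m (\sum_(x in D) deg F x)) => lem; [by left | right].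
have Fi x : F x x = false by apply/negP => /Fh; rewrite hi.
pose S := [set x in D | deg F x == 0]; pose W := D :\: S.
have WE x : x \in W = (x \in D) && (deg F x == 1).
  rewrite !inE; case: (x \in D) => //=; rewrite ?andbT ?andbF //.
  by have := Fk x; case: (deg F x) => [|[|]].
have cW : #|W| = \sum_(x in D) deg F x.
  rewrite -sum1_card [RHS]big_mkcond [LHS]big_mkcond; apply: eq_bigr => x _.
  rewrite WE; case: (x \in D) => //=.
  by have := Fk x; case: (deg F x) => [|[|]].
have cS : #|W| + #|S| = #|D|.
  by rewrite -(cardsID S D) addnC (setIidPr _) //; apply/subsetP => x; rewrite inE => /andP[].
have /card_gt1P[a [b [aS bS ab]]] : 1 < #|S| by clear -cS cW lem cD; lia.
have [aD /eqP da] : a \in D /\ deg F a == 0 by apply/andP; move: aS; rewrite inE.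
have [bD /eqP db] : b \in D /\ deg F b == 0 by apply/andP; move: bS; rewrite inE.
have addnew F' u v : symmetric F' -> u \in D -> v \in D -> u != v ->
    (forall x y, F' x y -> [&& h x y, x \in D & y \in D]) ->
    (forall z, deg F' z = deg F z + (z == u) + (z == v)) -> deg F u = 0 -> deg F v = 0 ->
    exists F', P F' /\ \sum_x deg F x < \sum_x deg F' x.
  move=> F's uD vD uv F'h E du dv; exists F'; split; last exact: sum_deg_incr E.
  split=> // z; rewrite E; case: (eqVneq z u) => [->|zu]; first by rewrite du (negPf uv).
  by case: (eqVneq z v) => [->|zv]; rewrite ?dv ?addn0.
have isol u v : deg F u = 0 -> ~~ F u v.
  by move=> du; apply/negP => Fuv; have : 0 < deg F u by [apply/deg_gt0P; exists v]; rewrite du.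
case: (pickP [pred p | [&& p.1 \in S, p.2 \in S & h p.1 p.2]]) => [[u v]|indep].
  rewrite /= !inE => /and3P[/andP[uD /eqP du] /andP[vD /eqP dv] huv].
  have uv : u != v by apply: contraTneq huv => ->; rewrite hi.
  apply: (addnew (add_edge F u v) u v) => //.
  - exact: add_edge_sym.
  - by move=> x y /add_edgeE[/Fh//|[] [-> ->]]; rewrite uD vD ?huv // hs huv.
  - by move=> z; rewrite deg_add // isol.
have nbr u : u \in S -> [set y in D | h u y] = W.
  move=> uS; have uD : u \in D by move: uS; rewrite inE => /andP[].
  apply/eqP; rewrite eqEcard reg // cW lem andbT; apply/subsetP => y.
  rewrite inE => /andP[yD huy]; rewrite in_setD yD andbT; apply/negP => yS.
  by have := indep (u, y); rewrite /= uS yS huy.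
have /card_gt0P[x xW] : 0 < #|W| by rewrite -(nbr a aS) reg.
have [xD /eqP dx] : x \in D /\ deg F x == 1 by apply/andP; rewrite -WE.
have /deg_gt0P[y Fxy] : 0 < deg F x by rewrite dx.
have /and3P[_ _ yD] := Fh _ _ Fxy.
have yW : y \in W.
  by rewrite WE yD eqn_leq Fk; apply/deg_gt0P; exists x; rewrite Fs.
have hax : h a x by move: xW; rewrite -(nbr a aS) inE => /andP[].
have hby : h b y by move: yW; rewrite -(nbr b bS) inE => /andP[].
have ax : a != x by apply: contraTneq hax => ->; rewrite hi.
have bY : b != y by apply: contraTneq hby => ->; rewrite hi.
have xy : x != y by apply: contraTneq Fxy => ->; rewrite Fi.
have ay : a != y by apply: contraTneq Fxy => <-; rewrite Fs isol.
apply: (addnew (switch F a x y b) a b) => //.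
- exact: switch_sym.
- move=> u v /switchE[/Fh//|[] [-> ->]|[] [-> ->]];
    by rewrite ?aD ?bD ?xD ?yD ?hax ?hby // hs ?hax ?hby.
- by move=> z; apply: switch_deg; rewrite // ?isol //; left.
Qed.

Lemma complete_of_regular h D x y : irreflexive h ->
  #|[set z in D | h x z]|.+1 = #|D| -> x \in D -> y \in D -> x != y -> h x y.
Proof.
move=> hi reg xD yD xy.
have E : [set z in D | h x z] = D :\ x.
  apply/eqP; rewrite eqEcard; have := cardsD1 x D; rewrite xD => c.
  apply/andP; split; last by clear -c reg; lia.
  apply/subsetP => z; rewrite !inE => /andP[-> hxz]; rewrite andbT.
  by apply: contraTneq hxz => ->; rewrite hi.
have : y \in D :\ x by rewrite !inE eq_sym xy.
by rewrite -E inE => /andP[].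
Qed.

Lemma complete_subset_factor D k : k < #|D| -> ~~ odd (k * #|D|) ->
  exists F, [/\ symmetric F, irreflexive F, forall x y, F x y -> (x \in D) && (y \in D),
    forall x, x \in D -> deg F x = k & forall x, deg F x <= k].
Proof.
move=> lt ev.
have [| | |F [Fs Fi Fd]] := @graphic T (fun x => if x \in D then k else 0) k.
- by move=> x; case: ifP.
- by rewrite -big_mkcond sum_nat_const mulnC.
- apply: leq_trans lt _; apply: subset_leq_card; apply/subsetP => x xD.
  by rewrite inE xD.
have FD x y : F x y -> x \in D.
  apply: contraLR => xD; have := Fd x; rewrite (negPf xD) => d0.
  by apply/negP => Fxy; have : 0 < deg F x by [apply/deg_gt0P; exists y]; rewrite d0.
exists F; split=> //.
- by move=> x y Fxy; rewrite (FD x y) // (FD y x) // Fs.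
- by move=> x xD; rewrite Fd xD.
- by move=> x; rewrite Fd; case: ifP.
Qed.

(** * Isomorphisms with the exceptional graphs *)

Lemma index_cat_lt (s1 s2 : seq T) x : (index x (s1 ++ s2) < size s1) = (x \in s1).
Proof.
by rewrite index_cat; case: ifPn => [|_]; rewrite ?index_mem // ltnNge leq_addr.
Qed.

(** Numbering by position in a list: concatenating the vertex classes turns each of them into an
    interval of indices. *)
Lemma enum_bijection n (s : seq T) : uniq s -> (forall x, x \in s) -> size s = n ->
  exists f : T -> 'I_n, bijective f /\ forall x, f x = index x s :> nat.
Proof.
move=> us ms ss; have lt x : index x s < n by rewrite -ss index_mem.
exists (fun x => Ordinal (lt x)); split=> //; apply: inj_card_bij.
  by move=> x y /(congr1 val) /= E; rewrite -(nth_index x (ms x)) E nth_index.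
by rewrite card_ord -ss cardE; apply: uniq_leq_size => // x _; rewrite mem_enum.
Qed.

Lemma iso_two_cliques n h D d : #|T| = n -> #|~: D| = d ->
  (forall x y, h x y = (x != y) && ((x \in D) == (y \in D))) ->
  iso_to n h (two_cliques n d).
Proof.
move=> cT cD hE; pose s := enum (~: D) ++ enum D.
have ss : size s = n by rewrite size_cat -!cardE addnC cardsC.
have [||f [fb fE]] := @enum_bijection n s _ _ ss.
- rewrite cat_uniq !enum_uniq andbT /=; apply/hasPn => x.
  by rewrite !mem_enum inE negbK.
- by move=> x; rewrite mem_cat !mem_enum inE; case: (x \in D).
exists f; split=> // x y; rewrite hE /two_cliques (bij_eq fb) !fE -cD !cardE !index_cat_lt.
by rewrite !mem_enum !inE; case: (x \in D); case: (y \in D).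
Qed.

Lemma iso_join_graph n h D C d : #|T| = n -> #|C| = d -> #|D| = d.+1 ->
  [disjoint D & C] ->
  (forall x y, h x y = (x != y) && [|| x \in C, y \in C | (x \notin D) && (y \notin D)]) ->
  iso_to n h (join_graph n d).
Proof.
move=> cT cC cD dis hE.
pose R := ~: (D :|: C); pose s := (enum C ++ enum R) ++ enum D.
have ss : size s = n.
  rewrite !size_cat -!cardE -cT -(cardsC (D :|: C)) -/R.
  have := cardsUI D C; rewrite (disjoint_setI0 dis) cards0.
  by clear; lia.
have sR : n - d - 1 = size (enum C ++ enum R).
  by rewrite -ss [in LHS]size_cat -cardE cD; clear; lia.
have mR x : (x \in enum C ++ enum R) = (x \notin D).
  rewrite mem_cat !mem_enum !inE; case: (boolP (x \in D)) => xD /=; last by case: (x \in C).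
  by rewrite (disjointFr dis xD).
have [||f [fb fE]] := @enum_bijection n s _ _ ss.
- rewrite !cat_uniq !enum_uniq !andbT /=; apply/andP; split.
    by apply/hasPn => x; rewrite !mem_enum !inE negb_or => /andP[].
  by apply/hasPn => x; rewrite mR mem_enum negbK.
- by move=> x; rewrite mem_cat mR mem_enum; case: (x \in D).
exists f; split=> // x y; rewrite hE /join_graph (bij_eq fb) !fE sR !index_cat_lt !mR.
by rewrite /s -!catA -cC !cardE !index_cat_lt !mem_enum.
Qed.

End Extend.

(** * The extremal split *)

Section Split.
Variables (T : finType) (n delta : nat) (h : rel T) (D : {set T}).
Hypothesis cardT : #|T| = n.
Hypothesis hP : simple_graph h.
Hypothesis degD : forall x, x \in D -> deg h x = delta.
Hypothesis clq : forall x y, x \notin D -> y \notin D -> x != y -> h x y.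
Hypothesis all_or_none : forall x, x \notin D ->
  (forall y, y \in D -> h x y) \/ (forall y, y \in D -> ~~ h x y).
Hypothesis D0 : D != set0.

(** By [all_or_none], the other vertices outside [D] have no neighbour in [D]. So every vertex of
    [D] has exactly [C] as its outside neighbours, and [h] is regular on [D]. *)
Definition full_nbrs : {set T} := [set x in ~: D | [forall y in D, h x y]].
Let C := full_nbrs.

Lemma full_nbrsP x y : x \in D -> y \in C -> h x y.
Proof.
have [_ hs] := hP.
by move=> xD; rewrite !inE => /andP[_ /forall_inP/(_ x xD)]; rewrite hs.
Qed.

Lemma disjoint_full : [disjoint D & C].
Proof.
by rewrite disjoint_sym disjoints_subset; apply/subsetP => x; rewrite !inE => /andP[].
Qed.

Lemma nbr_low x y : x \in D -> y \notin D -> h x y = (y \in C).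
Proof.
have [_ hs] := hP.
move=> xD yD; apply/idP/idP => [hxy|]; last exact: full_nbrsP.
rewrite !inE yD; apply/forall_inP; case: (all_or_none yD) => // no.
by have := no x xD; rewrite hs hxy.
Qed.

Lemma reg_low x : x \in D -> #|C| + #|[set y in D | h x y]| = delta.
Proof.
move=> xD; rewrite -(degD xD) addnC /deg -(cardsID D [set y | h x y]); congr addn.
  by apply: eq_card => y; rewrite !in_set andbC.
apply: eq_card => y; rewrite in_setD in_set.
case: (boolP (y \in D)) => yD /=; last by rewrite nbr_low.
by rewrite (disjointFr disjoint_full yD).
Qed.

Lemma card_outside : #|~: (D :|: C)| + #|D| + #|C| = n.
Proof.
have := cardsUI D C; rewrite (disjoint_setI0 disjoint_full) cards0.
by rewrite -cardT -(cardsC (D :|: C)); clear; lia.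
Qed.

Lemma low_bound x : x \in D -> #|[set y in D | h x y]| < #|D|.
Proof.
have [hi _] := hP.
move=> xD; rewrite (cardsD1 x D) xD ltnS; apply: subset_leq_card; apply/subsetP => y.
rewrite !inE => /andP[-> hxy]; rewrite andbT.
by apply: contraTneq hxy => ->; rewrite hi.
Qed.

(** A saturated subgraph of [h] on [D] is extended; its total deficit fits by [saturated_sum] with
    [c = #|C|]. Since [m < #|D|] gives [#|C| >= 2 * k - 3], the single demands can exceed [#|C|]
    only when [k = 2] and [#|C| = 1]. *)
Lemma kfactor_split k : 1 < k -> #|D| + 2 * k = delta + 4 -> 2 * k - 2 <= delta ->
  2 * delta + k + 1 <= n -> ~~ odd (n * k) -> has_kfactor h k.
Proof.
move=> k2 cD dk dn ev; have [hi hs] := hP.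
have /set0Pn[y0 y0D] := D0.
pose m := delta - #|C|.
have regm x : x \in D -> #|[set y in D | h x y]| = m.
  by move=> xD; rewrite /m -(reg_low xD) addKn.
have mE : #|C| + m = delta by rewrite -(regm _ y0D) reg_low.
have mD : m < #|D| by rewrite -(regm _ y0D) low_bound.
have out := card_outside; rewrite -/C in out.
have big : k < #|~: (D :|: C)| by clear -out mE mD cD dn k2; lia.
have evT : ~~ odd (#|T| * k) by rewrite cardT.
have build := kfactor_extend hP clq full_nbrsP disjoint_full.
(* Here [D] is complete on [m.+1 >= 3] vertices, so a 2-factor of [D] is used and leaves no
   demand. *)
case: (boolP [&& k == 2, #|C| == 1 & 1 < m]) => [/and3P[/eqP kE /eqP cC m1]|special].
  have Dm : #|D| = m.+1 by clear -cD kE cC mE; lia.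
  have [||F [Fs Fi FD Fk Fle]] := @complete_subset_factor T D k.
  - by rewrite Dm kE.
  - by rewrite kE oddM.
  have Fh x y : F x y -> [&& h x y, x \in D & y \in D].
    move=> Fxy; have /andP[xD yD] := FD _ _ Fxy; rewrite xD yD !andbT.
    apply: (@complete_of_regular _ h D) => //; first by rewrite regm.
    by apply: contraTneq Fxy => ->; rewrite Fi.
  apply: (build F k) => //.
  - by move=> y yD; rewrite Fk // leq_addl.
  - by rewrite big1 // => x xD; rewrite Fk // subnn.
have [F [Fs Fh Fk sat]] := saturated_subgraph D k hP.
apply: (build F k) => //; last first.
  apply: (saturated_sum k2 hi regm Fh Fk sat Fs).
  by clear -cD mE; lia.
move=> y yD; case: (leqP k #|C|) => [le|lt]; first exact: leq_trans le (leq_addr _ _).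
(* In the remaining case [D] is a single edge, which saturation puts into [F]. *)
have [k2E cC] : k = 2 /\ #|C| = 1 by clear -lt cD mD mE k2; lia.
have m1 : m = 1.
  by move: special; rewrite k2E cC !eqxx /=; clear -mE cC dk k2E; lia.
have D2 : #|D| = 2 by clear -cD k2E mE cC m1; lia.
have : 0 < #|[set z in D | h y z]| by rewrite regm // m1.
case/card_gt0P => z; rewrite inE => /andP[zD hyz].
have Fsmall : deg F z < k.
  rewrite k2E -D2; have := low_bound zD; apply: leq_ltn_trans; apply: subset_leq_card.
  by apply/subsetP => w; rewrite !inE => /Fh/and3P[-> _ ->].
have : 0 < deg F y.
  case: (leqP k (deg F y)) => [|Fy]; first exact: leq_trans (ltnW k2).
  by apply/deg_gt0P; exists z; apply: sat.
by rewrite k2E cC; clear; lia.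
Qed.

(** If [C] is empty, [D] is a separate clique on [delta.+1] vertices, matchable exactly for odd
    [delta]. If [m = 0], [D] is independent and the join graph appears. Otherwise [regular_matching]
    leaves at most [delta - m = #|C|] vertices of [D] to be matched into [C]. *)
Lemma perfect_matching_split : 0 < delta -> #|D| = delta.+1 ->
  2 * delta + 2 <= n -> ~~ odd n ->
  [\/ has_kfactor h 1,
      ~~ odd delta /\ iso_to n h (two_cliques n (n - delta - 1)) |
      iso_to n h (join_graph n delta)].
Proof.
move=> d0 cD dn ev; have [hi hs] := hP.
have /set0Pn[y0 y0D] := D0.
pose m := delta - #|C|.
have regm x : x \in D -> #|[set y in D | h x y]| = m.
  by move=> xD; rewrite /m -(reg_low xD) addKn.
have mE : #|C| + m = delta by rewrite -(regm _ y0D) reg_low.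
have out := card_outside; rewrite -/C in out.
have build := kfactor_extend hP clq full_nbrsP disjoint_full.
have evT : ~~ odd (#|T| * 1) by rewrite cardT muln1.
have big : 0 < m \/ #|C| = 0 -> 1 < #|~: (D :|: C)| by clear -out mE cD dn d0; lia.
case: (eqVneq #|C| 0) => cC.
  have Dm : #|D| = m.+1 by rewrite cD -mE cC.
  have Dh x y : x \in D -> y \in D -> x != y -> h x y.
    by move=> xD; apply: complete_of_regular => //; rewrite regm.
  case: (boolP (odd delta)) => odd_delta.
    have [||F [Fs Fi FD Fk Fle]] := @complete_subset_factor T D 1.
    - by rewrite cD.
    - by rewrite mul1n cD /= odd_delta.
    apply: Or31; apply: (build F 1) => //.
    - move=> x y Fxy; have /andP[xD yD] := FD _ _ Fxy; rewrite xD yD !andbT.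
      by apply: Dh => //; apply: contraTneq Fxy => ->; rewrite Fi.
    - by move=> y yD; rewrite Fk // leq_addl.
    - by rewrite big1 // => x xD; rewrite Fk // subnn.
    - by apply: big; right.
  apply: Or32; split=> //; apply: (@iso_two_cliques _ _ _ D) => //.
    by have := cardsC D; rewrite cardT cD; clear; lia.
  have C0 z : z \notin C by move/eqP: cC; rewrite cards_eq0 => /eqP->; rewrite inE.
  move=> x y; case: (eqVneq x y) => [->|xy]; first by rewrite hi.
  case: (boolP (x \in D)) => xD; case: (boolP (y \in D)) => yD /=.
  - exact: Dh.
  - by rewrite nbr_low // (negPf (C0 _)).
  - by rewrite hs nbr_low // (negPf (C0 _)).
  - exact: clq.
case: (posnP m) => [m0|m_gt0].
  apply: Or33; apply: (@iso_join_graph _ _ _ D C) => //.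
  - by rewrite -mE m0 addn0.
  - exact: disjoint_full.
  have DD x y : x \in D -> y \in D -> ~~ h x y.
    move=> xD yD; have /eqP := regm x xD; rewrite m0 cards_eq0 => /eqP/setP/(_ y).
    by rewrite in_set0 in_set yD /= => ->.
  have CD z : z \in D -> z \notin C by move=> zD; rewrite (disjointFr disjoint_full zD).
  move=> x y; case: (eqVneq x y) => [->|xy]; first by rewrite hi.
  case: (boolP (x \in D)) => xD; case: (boolP (y \in D)) => yD /=.
  - by rewrite (negPf (DD _ _ xD yD)) (negPf (CD x _)) // (negPf (CD y _)).
  - by rewrite nbr_low // (negPf (CD x _)) // orbF.
  - by rewrite hs nbr_low // (negPf (CD y _)) // !orbF.
  - by rewrite clq // !orbT.
have cDm : m.+1 < #|D| by clear -cD mE cC; lia.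
have [F [Fs Fh Fk Fsum]] := regular_matching hP m_gt0 cDm regm.
apply: Or31; apply: (build F 1) => //.
- by move=> y yD; clear -cC; rewrite -/C; lia.
- have : \sum_(x in D) (1 - deg F x) + \sum_(x in D) deg F x = #|D|.
    by rewrite -big_split /= -sum1_card; apply: eq_bigr => x _; exact: subnK.
  by rewrite -/C; clear -Fsum cD mE; lia.
- by apply: big; left.
Qed.

End Split.

(** * Assembly of both statements through the closure *)

Theorem theorem1p3 (r k delta n : nat) (T : finType) (g : rel T) :
  simple_graph g ->
  2 <= r -> 1 <= k ->
  #|T| = n -> 2 * delta + k + 1 <= n -> ~~ odd (n * k) ->
  (forall x, delta <= deg g x) ->
  (* (i) *)
  (~~ odd n -> 1 <= delta -> delta <= n./2 - 1 ->
   maxn (varphi n r delta.+1) (varphi n r (n./2 - 1)) < Nr g r ->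
   has_kfactor g 1
   \/ (~~ odd delta /\ exists h, is_closure (n - 1) g h /\
          iso_to n h (two_cliques n (n - delta - 1)))
   \/ (exists h, is_closure (n - 1) g h /\ iso_to n h (join_graph n delta)))
  /\
  (* (ii) *)
  (2 <= k -> 2 * k - 2 <= delta -> delta <= (n + 2 * k - 5) %/ 2 ->
   maxn (phi n r k delta.+1) (phi n r k ((n + 2 * k - 5) %/ 2)) < Nr g r ->
   has_kfactor g k).
Proof.
move=> gP r2 k1 cT dn ev mind; have r0 : 0 < r := ltnW r2.
(* [b] is the largest [q] with [q.*2 < l], so [delta.+1] and [b] are the ends of the range of [q] to
   be controlled, and convexity reduces it to them. *)
have interval l b : b.*2 < l <= b.*2.+2 -> l <= n + delta -> delta.*2 < l ->
    maxn (psi n l r delta.+1) (psi n l r b) < Nr g r ->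
    exists h, [/\ is_closure l g h, simple_graph h &
      (forall x y, x != y -> h x y) \/
      exists D : {set T}, [/\ D != set0, #|D| + l = n + delta,
        forall x, x \in D -> deg h x = delta,
        forall x y, x \notin D -> y \notin D -> x != y -> h x y &
        forall x, x \notin D ->
          (forall y, y \in D -> h x y) \/ (forall y, y \in D -> ~~ h x y)]].
  move=> lb len dl big; have [h [hreach hcl]] := closure_exists l gP.
  have hP := closure_simple gP hreach.
  have gh x y : g x y -> h x y := closure_sub hreach.
  have minh x : delta <= deg h x.
    by apply: leq_trans (mind x) (subset_leq_card _); apply/subsetP => y; rewrite !inE; exact: gh.
  have bigh : maxn (psi n l r delta.+1) (psi n l r b) < Nr h r.
    exact: leq_trans big (Nr_mono r gh).
  have [||clq low] := closed_structure cT hP r0 hcl minh len dl.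
  - by apply: leq_ltn_trans (leq_maxl _ _) bigh.
  - move=> q dq ql; apply: leq_ltn_trans bigh; apply: convex_max.
      by move=> p dp pb; apply: psi_convex; clear -dp pb lb len; lia.
    by clear -dq ql lb; lia.
  exists h; split=> //; set D := finset _ in clq low.
  (* Without vertices of degree [delta] the closure is complete. *)
  case: (eqVneq D set0) => [D0|Dn0]; [left|right].
    by move=> x y; apply: clq; rewrite D0 inE.
  have [cD aon] := low Dn0; exists D; split=> //.
  by move=> x; rewrite inE => /eqP.
split=> [evn d0 d1 big|k2 dk d1 big].
  have [||||h [[hreach hcl] hP]] := interval (n - 1) (n./2 - 1).
  - by clear -evn d0 d1; lia.
  - by clear -dn d0; lia.
  - by clear -dn k1; lia.
  - by rewrite -!varphiE //; clear -dn; lia.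
  have fac : has_kfactor h 1 -> has_kfactor g 1.
    by apply: kfactor_closure hreach => //; rewrite cT /= addn0.
  case=> [complete|[D [D0 cD degD clq aon]]].
    left; apply: fac; apply: complete_kfactor => //; rewrite cT ?muln1 //.
    by clear -dn k1 d0; lia.
  have [||||two|join] := perfect_matching_split cT hP degD clq aon D0 d0.
  - by clear -cD dn; lia.
  - by clear -dn k1; lia.
  - by [].
  - by move/fac; left.
  - by case: two => ed two; right; left; split=> //; exists h.
  - by right; right; exists h.
have [||||h [[hreach hcl] hP]] := interval (n + 2 * k - 4) ((n + 2 * k - 5) %/ 2).
- by clear -dn k2; lia.
- by clear -dn dk k2; lia.
- by clear -dn k2; lia.
- by rewrite -!phiE //; clear -dn k2; lia.
have fac : has_kfactor h k -> has_kfactor g k.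
  apply: kfactor_closure hreach => //; rewrite cT; case: eqP => [kE|_].
    by rewrite kE in k2.
  by clear -dn k2; lia.
case=> [complete|[D [D0 cD degD clq aon]]]; apply: fac.
  by apply: complete_kfactor => //; rewrite cT //; clear -dn; lia.
apply: (kfactor_split cT hP degD clq aon D0) => //.
by clear -cD dk k2 dn; lia.
Qed.
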